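(* Let $X$ be a branchwise-real tree order. Then $X$ has a continuous $\mathbb{R}$-grading if and only if it has an $\mathbb{R}$-grading.
   Context: A tree order is a partial order with a minimum element (root) such that for every $x$ the set $\{y\mid y\le x\}$ is linearly ordered; a branch is a maximal linearly ordered subset. A branchwise-real tree order is a tree order in which every branch is order-isomorphic to a real interval and any two elements have a greatest lower bound. An $\mathbb{R}$-grading is a strictly monotonic map $\ell\colon X\to\mathbb{R}$; it is continuous if for all $x<y$ in $X$ the restriction of $\ell$ to $[x,y]=\{z\mid x\le z\le y\}$ is an order-isomorphism onto $[\ell(x),\ell(y)]$. *)

(* Defs.v *)
From mathcomp Require Import all_boot all_order all_algebra.
From mathcomp Require Import all_classical all_reals normedtype.

Set Implicit Arguments.
Unset Strict Implicit.
Unset Printing Implicit Defensive.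

Local Open Scope classical_set_scope.
Local Open Scope order_scope.

Section Orders.
Context {d d' : Order.disp_t} {X : porderType d} {Y : porderType d'}.

Definition linearly_ordered (A : set X) : Prop :=
  total_on A (fun x y => x <= y).

Definition branch (B : set X) : Prop :=
  linearly_ordered B /\
  forall C : set X, linearly_ordered C -> B `<=` C -> C = B.

(* [f] is total on [X], but only its values on [A] matter. *)
Definition order_iso_on (A : set X) (B : set Y) (f : X -> Y) : Prop :=
  set_bij A B f /\ forall x y, A x -> A y -> (x <= y <-> f x <= f y).

End Orders.

Definition tree_order {d : Order.disp_t} (X : porderType d) : Prop :=
  (exists r : X, forall x : X, r <= x) /\
  forall x : X, linearly_ordered [set y : X | y <= x].

(* [is_interval] is order-convexity, so it covers every open, closed,
   half-open, bounded or unbounded interval, including degenerate ones. *)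
Definition branchwise_real (R : realType) {d : Order.disp_t}
    (X : porderType d) : Prop :=
  [/\ tree_order X,
      forall B : set X, branch B ->
        exists (I : set R) (f : X -> R), is_interval I /\ order_iso_on B I f
    & forall x y : X, exists m : X, infimums [set x; y] m].

Definition grading {R : realType} {d : Order.disp_t} {X : porderType d}
    (l : X -> R) : Prop :=
  {homo l : x y / x < y}.

Definition continuous_grading {R : realType} {d : Order.disp_t}
    {X : porderType d} (l : X -> R) : Prop :=
  grading l /\
  forall x y : X, x < y -> order_iso_on `[x, y] `[l x, l y] l.

(* Main.v *)
(** Fix a grading [l].  Zorn's lemma is applied to pairs (D, g) where D is a
downward closed subtree containing the root and g <= l is a continuous grading
of D.  The invariant g <= l is what makes limit steps possible: at a point p
outside D with everything below p in D, the supremum of g below p is bounded by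
[l p], so g extends continuously.  Otherwise D meets the segment below some z in
a closed segment with top p < z, and g is extended along [p, z] by a continuous
strictly increasing function that starts at [g p] and stays below l; it exists
because a strictly increasing function on a real segment has a continuous
strictly increasing minorant with the same initial value. *)

Require Import Defs.
From mathcomp Require Import all_boot all_order all_algebra.
From mathcomp Require Import all_classical all_reals topology normedtype.
From mathcomp Require Import lra.

Set Implicit Arguments.
Unset Strict Implicit.
Unset Printing Implicit Defensive.

Import Order.TTheory GRing.Theory Num.Theory numFieldNormedType.Exports.

Local Open Scope classical_set_scope.

(** * Continuous strictly increasing minorants on a real segment *)

Section Minorant.
Local Open Scope ring_scope.
Context {R : realType}.

Lemma nonexpansive_continuous (k : R -> R) :
  (forall s t, `|k s - k t| <= `|s - t|) -> continuous k.
Proof.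
move=> kL s; apply/cvgrPdist_lt => e e0; near=> t.
by apply: le_lt_trans (kL s t) _; near: t; exact: cvgr_dist_lt.
Unshelve. all: by end_near. Qed.

Lemma continuous_minorant (a b : R) (u : R -> R) : a < b ->
  {in `[a, b] &, {homo u : x y / x < y}} ->
  exists H : R -> R, [/\ continuous H, H a = u a,
    {in `[a, b] &, {homo H : x y / x < y}} &
    {in `[a, b], forall x, H x <= u x}].
Proof.
move=> ab uM.
(* [k] is the largest nonexpansive nondecreasing minorant of [u - u a]; the
   factor [(s - a) / (b - a)] below makes it strictly increasing. *)
pose E s := [set u t - u a + Num.max (s - t) 0 | t in `[a, b]].
pose k s := inf (E s).
have ain : a \in `[a, b] by rewrite in_itv /= lexx ltW.
have u_ge t : t \in `[a, b] -> u a <= u t.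
  move=> tab; have := tab; rewrite in_itv /= => /andP[].
  by rewrite le_eqVlt => /predU1P[-> //|at_ _]; exact/ltW/uM.
have E0 s : E s !=set0 by exists (u a - u a + Num.max (s - a) 0), a.
have El s : has_lbound (E s).
  exists 0 => _ [t /u_ge ut <-].
  by rewrite addr_ge0 ?subr_ge0// le_max lexx orbT.
have kle s t : t \in `[a, b] -> k s <= u t - u a + Num.max (s - t) 0.
  by move=> tab; apply: ge_inf => //; exists t.
(* For each fixed [t] the expression under the infimum is nonexpansive and nondecreasing in [s];
   both properties pass to the infimum [k]. *)
have kD s s' : k s <= k s' + `|s - s'|.
  rewrite -lerBlDr; apply: lb_le_inf => // _ [t tab <-].
  rewrite lerBlDr; apply: le_trans (kle s t tab) _.
  rewrite -[leRHS]addrA lerD2l ge_max; apply/andP; split; last first.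
    by rewrite addr_ge0// le_max lexx orbT.
  have -> : s - t = s' - t + (s - s') by lra.
  by rewrite lerD ?ler_norm// le_max lexx.
have kM s s' : s <= s' -> k s <= k s'.
  move=> ss'; apply: lb_le_inf => // _ [t tab <-].
  apply: le_trans (kle s t tab) _; rewrite lerD2l.
  by rewrite ge_max !le_max lexx !orbT lerD2r ss'.
have kc : continuous k.
  apply: nonexpansive_continuous => s t; rewrite ler_norml.
  by have := kD s t; have := kD t s; rewrite [`|t - s|]distrC; lra.
(* The midpoint [m] of [a] and [s] gives a bound uniform in [t]: for [t] at or beyond [m] the term
   [u t - u a] is at least [u m - u a], and for [t] before [m] the penalty exceeds [s - m]. *)
have k0 s : s \in `[a, b] -> a < s -> 0 < k s.
  rewrite in_itv /= => /andP[_ sb] as_; pose m := (a + s) / 2.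
  have [am ms] : a < m /\ m < s by rewrite /m; split; lra.
  have min_ : m \in `[a, b].
    by rewrite in_itv /= (ltW am)/= (le_trans (ltW ms)).
  apply: (@lt_le_trans _ _ (Num.min (u m - u a) (s - m))).
    by rewrite lt_min !subr_gt0 ms uM.
  apply: lb_le_inf => // _ [t tab <-]; rewrite ge_min.
  have [mt|tm] := leP m t; apply/orP; [left|right].
    rewrite -[leLHS]addr0; apply: lerD; last by rewrite le_max lexx orbT.
    rewrite lerD2r; move: mt; rewrite le_eqVlt => /predU1P[-> //|mt].
    exact/ltW/uM.
  rewrite -[leLHS]add0r; apply: lerD; first by rewrite subr_ge0 u_ge.
  by rewrite le_max lerD2l lerN2 (ltW tm).
exists (fun s => u a + k s * ((s - a) / (b - a))); split.
- move=> s; apply: cvgD; first exact: cvg_cst.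
  apply: cvgM; first exact: kc.
  apply: cvgM; last exact: cvg_cst.
  by apply: cvgB; [exact: cvg_id|exact: cvg_cst].
- by rewrite subrr mul0r mulr0 addr0.
- move=> x y; rewrite !in_itv /= => /andP[ax xb] /andP[ay yb] xy.
  have yab : y \in `[a, b] by rewrite in_itv /= ay yb.
  (* The intermediate product uses [k y], which is positive because [y] lies beyond [a]; [k x]
     vanishes when [x] is [a]. *)
  rewrite ltrD2l; apply: (@le_lt_trans _ _ (k y * ((x - a) / (b - a)))).
    by rewrite ler_wpM2r ?kM// ?(ltW xy)// divr_ge0 ?subr_ge0// ltW.
  rewrite ltr_pM2l ?k0// ?(le_lt_trans ax)//.
  by rewrite ltr_pM2r ?ltrD2r// invr_gt0 subr_gt0.
- move=> x xab; have := xab; rewrite !in_itv /= => /andP[ax xb].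
  have kx : k x <= u x - u a.
    by have := kle x x xab; rewrite subrr maxxx addr0.
  rewrite -lerBrDl; apply: le_trans kx.
  have k_ge0 : 0 <= k x.
    apply: lb_le_inf => // _ [t /u_ge ut <-].
    by rewrite addr_ge0 ?subr_ge0// le_max lexx orbT.
  by rewrite ler_piMr// ler_pdivrMr ?subr_gt0// mul1r lerD2r.
Qed.

End Minorant.

(** * Real coordinates on the segments of the tree *)

Section Tree.
Local Open Scope order_scope.
Context {R : realType} {d : Order.disp_t} {X : porderType d}.
Hypothesis hX : branchwise_real R X.

Lemma branch_above (z : X) :
  exists B : set X, branch B /\ [set y | y <= z] `<=` B.
Proof.
case: hX => -[_ /(_ z) L _ _].
(* Joining the down-set of [z] inside [P], instead of requiring [A] to contain it, lets the empty
   chain satisfy the hypothesis of Zorn's lemma. *)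
pose P (A : set X) := linearly_ordered (A `|` [set y | y <= z]).
have [|A [PA Amax]] := @Zorn_bigcup X P.
  move=> F FP Ftot x y [[A FA Ax]|xz] [[B FB By]|yz].
  - have [AB|BA] := Ftot _ _ FA FB.
      by apply: (FP _ FB); left => //; exact: AB.
    by apply: (FP _ FA); left => //; exact: BA.
  - by apply: (FP _ FA); [left|right].
  - by apply: (FP _ FB); [right|left].
  - exact: L.
exists (A `|` [set y | y <= z]); split; last exact: subsetUr.
split=> // C LC AC; apply/seteqP; split=> // x Cx; left.
apply: contrapT => nAx; apply: (Amax (A `|` [set x])).
  split; first exact: subsetUl.
  by move=> /(_ x) h; apply/nAx/h; right.
move=> s t Hs Ht; apply: LC.
  by case: Hs => [[?|->//]|?]; apply: AC; [left|right].
by case: Ht => [[?|->//]|?]; apply: AC; [left|right].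
Qed.

(** A branch through [z] contains everything below [z], so its isomorphism [f] with an interval
    restricts to the down-set. Convexity of the interval makes every value between [f r] and [f z] a
    coordinate, and [w] inverts [f]. *)
Lemma segment_coordinates (r z : X) : r <= z ->
  exists (f : X -> R) (w : R -> X),
  [/\ forall x y, x <= z -> y <= z -> (f x <= f y) = (x <= y),
      forall x y, x <= z -> y <= z -> (f x < f y) = (x < y),
      forall x, x <= z -> w (f x) = x &
      forall s, f r <= s -> s <= f z -> w s <= z /\ f (w s) = s].
Proof.
move=> rz; have [B [hB zB]] := branch_above z.
case: hX => _ /(_ B hB) [I [f [iI [[fI finj fsurj] fmono]]]] _.
have fE x y : x <= z -> y <= z -> (f x <= f y) = (x <= y).
  by move=> /zB Bx /zB By; apply/idP/idP; case: (fmono _ _ Bx By).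
(* The default [r] is taken only at reals that are not coordinates of points below [z], where
   nothing is claimed. *)
pose w s := xget r [set x | x <= z /\ f x = s].
have wP s : (exists2 x, x <= z & f x = s) -> w s <= z /\ f (w s) = s.
  by case=> x xz fx; rewrite /w; case: xgetP => [y -> //|/(_ x)[]].
exists f, w; split=> // [x y xz yz|x xz|s rs sz].
- by rewrite !lt_leAnge !fE.
- have [wz fw] := wP (f x) (ex_intro2 _ _ x xz erefl).
  by apply: finj => //; rewrite inE; exact: zB.
- apply: wP; have [|x Bx fx] := fsurj s.
    apply: (iI (f r) (f z)) => //; last exact/andP.
      exact/fI/zB.
    by apply/fI/zB => /=.
  by exists x => //; apply/(fmono _ _ Bx (zB z (lexx z))); rewrite fx.
Qed.

Variables (r : X) (l : X -> R).
Hypotheses (r_le : forall x, r <= x) (l_grading : grading l).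

Lemma segment_dense (x p : X) : x < p -> exists2 y, x < y & y < p.
Proof.
move=> xp; have [f [w [fE fL _ wP]]] := segment_coordinates (r_le p).
have xp' := ltW xp; have fxp : (f x < f p)%R by rewrite fL.
have frx : (f r <= f x)%R by rewrite fE.
have [||wp fw] := wP ((f x + f p) / 2)%R; [by lra..|].
exists (w ((f x + f p) / 2)%R).
  by rewrite -fL// fw; lra.
by rewrite -fL// fw; lra.
Qed.

(** * Partial gradings and their extensions *)

(* Below a point everything is linearly ordered, so hitting every value in
   [[g r, g y]] below [y] already gives continuity on all segments of [D]. *)
Definition partial_grading (D : set X) (g : X -> R) : Prop :=
  [/\ D r,
      forall x y, x <= y -> D y -> D x,
      forall x y, D y -> x < y -> g x < g y,
      forall x, D x -> g x <= l x &
      forall y v, D y -> g r <= v -> v <= g y -> exists2 w, w <= y & g w = v].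

Definition extends (D D' : set X) (g g' : X -> R) : Prop :=
  D `<=` D' /\ forall x, D x -> g' x = g x.

(** The point [p] is the one whose coordinate is the supremum of the coordinates of [D] below [z].
    Whether [p] lies in [D] is left open; the two cases call for different extensions. *)
Lemma cut_point (D : set X) (z : X) : D r ->
  (forall x y, x <= y -> D y -> D x) ->
  exists p, [/\ p <= z, forall x, x <= z -> D x -> x <= p &
    forall x, x < p -> D x].
Proof.
move=> Dr Ddown; have [f [w [fE fL fK wP]]] := segment_coordinates (r_le z).
pose S := [set f x | x in [set x | x <= z /\ D x]].
have Sr : S (f r) by exists r; split.
have Sub : ubound S (f z) by move=> _ [x [xz _] <-]; rewrite fE.
have Sle := ub_le_sup (ex_intro _ _ Sub : has_ubound S).
have [||pz fp] := wP (sup S); first exact: Sle.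
  by apply: ge_sup => //; exists (f r).
exists (w (sup S)); split=> // x.
  by move=> xz Dx; rewrite -fE// fp; apply: Sle; exists x.
move=> xp; have xz := ltW (lt_le_trans xp pz).
have : (f x < sup S)%R by rewrite -fp fL.
move=> /sup_gt[|_ [y [yz Dy] <-] xy]; first by exists (f r).
by apply: Ddown Dy; rewrite -fE// ltW.
Qed.

(** The value at [p] is forced to be [sup S]: a smaller one would break monotonicity, a larger one
    would skip values. *)
Lemma extend_at_limit (D : set X) (g : X -> R) (p : X) :
  partial_grading D g -> ~ D p -> (forall x, x < p -> D x) ->
  exists g', partial_grading (p |` D) g' /\ extends D (p |` D) g g'.
Proof.
move=> [Dr Ddown gM gl gS] nDp Dlt.
have neqp x : D x -> x != p by move=> Dx; apply/eqP => xp; rewrite xp in Dx.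
pose S := [set g y | y in [set y | y < p]].
have rp : r < p by rewrite lt_neqAle neqp/=.
have S0 : S !=set0 by exists (g r), r.
have Sle : ubound S (sup S).
  apply: ub_le_sup; exists (l p) => _ [y yp <-].
  by rewrite (le_trans (gl y (Dlt y yp)))// ltW// l_grading.
have Sl : sup S <= l p.
  apply: ge_sup => // _ [y yp <-].
  by rewrite (le_trans (gl y (Dlt y yp)))// ltW// l_grading.
pose g' x := if x == p then sup S else g x.
have g'p : g' p = sup S by rewrite /g' eqxx.
have g'D x : D x -> g' x = g x by move=> /neqp /negPf xp; rewrite /g' xp.
exists g'; split; last by split => //; exact: subsetUr.
split.
- by right.
- move=> x y xy [yp|Dy]; last by right; exact: Ddown Dy.
  by move: xy; rewrite yp le_eqVlt => /predU1P[->|/Dlt]; [left|right].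
- move=> x y [->|Dy] xy; last by rewrite !g'D ?gM//; exact: Ddown (ltW xy) Dy.
  rewrite g'p g'D; last exact: Dlt.
  (* A point strictly between [x] and [p] shows that the supremum is not attained below [p], hence
     the strict inequality. *)
  have [y' xy' y'p] := segment_dense xy.
  apply: (@lt_le_trans _ _ (g y')); first by apply: gM => //; exact: Dlt.
  by apply: Sle; exists y'.
- by move=> x [->|Dx]; [rewrite g'p|rewrite g'D ?gl].
- move=> y v yD; rewrite g'D// => rv.
  have gw u w : D u -> w <= u -> g w = v -> g' w = v.
    by move=> Du wu <-; apply: g'D; exact: Ddown Du.
  case: yD => [->|Dy]; last first.
    rewrite g'D// => vy; have [w wy wv] := gS y v Dy rv vy.
    by exists w => //; exact: gw Dy wy wv.
  rewrite g'p le_eqVlt => /predU1P[->|/(sup_gt S0)[_ [u up <-] vu]].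
    by exists p; rewrite ?g'p.
  have [w wu wv] := gS u v (Dlt u up) rv (ltW vu).
  by exists w; [exact: le_trans (ltW up)|exact: gw (Dlt u up) wu wv].
Qed.

(** The new points all lie between [p] and [z]. There the grading is a translate of a continuous
    minorant of [l], read in the coordinate [f]. *)
Lemma extend_along_segment (D : set X) (g : X -> R) (p z : X) :
  partial_grading D g -> D p -> p < z ->
  (forall x, x <= z -> D x -> x <= p) ->
  exists g', partial_grading (D `|` [set x | x <= z]) g' /\
    extends D (D `|` [set x | x <= z]) g g'.
Proof.
move=> [Dr Ddown gM gl gS] Dp pz Dz.
have [f [w [fE fL fK wP]]] := segment_coordinates (r_le z).
have pz' := ltW pz; have fpz : (f p < f z)%R by rewrite fL.
have inP y : p <= y -> y <= z -> f y \in `[f p, f z].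
  by move=> py yz; rewrite in_itv /= !fE// py.
have wE s : s \in `[f p, f z] -> w s <= z /\ f (w s) = s.
  rewrite in_itv /= => /andP[ps sz]; apply: wP => //.
  by apply: le_trans ps; rewrite fE.
have [|H [Hc Hp HM Hl]] := @continuous_minorant R _ _ (l \o w) fpz.
  move=> s t sI tI st; apply: l_grading.
  by have [? ws] := wE _ sI; have [? wt] := wE _ tI; rewrite -fL// ws wt.
(* Since [H (f p)] equals [l p], this shift makes the new part start at [g p]; being nonpositive, it
   keeps the new values below [l]. *)
pose c := (g p - l p)%R.
have c0 : (c <= 0)%R by rewrite subr_le0 gl.
have {}Hp : (c + H (f p) = g p)%R.
  by rewrite Hp /= fK// /c subrK.
pose g' x := if `[< D x >] then g x else (c + H (f x))%R.
have g'D x : D x -> g' x = g x by move=> Dx; rewrite /g' asboolT.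
have g'N x : ~ D x -> g' x = (c + H (f x))%R by move=> Dx; rewrite /g' asboolF.
have above y : y <= z -> ~ D y -> p < y.
  move=> yz nDy; case: hX => -[_ /(_ z) L _ _].
  have [yp|py] := L y p yz pz'; first by case: nDy; exact: Ddown Dp.
  (* Equality is excluded because [p] lies in [D] and [y] does not. *)
  by rewrite lt_neqAle py andbT; apply/eqP => yp; rewrite yp in Dp.
have g'pz y : p <= y -> y <= z -> g' y = (c + H (f y))%R.
  move=> py yz; have [Dy|/g'N//] := pselect (D y).
  have -> : y = p by apply/le_anti; rewrite py Dz.
  by rewrite g'D.
exists g'; split; last by split => //; exact: subsetUl.
split.
- by left.
- move=> x y xy [Dy|yz]; first by left; exact: Ddown Dy.
  by right; exact: le_trans yz.
- move=> x y; have [Dy _ xy|nDy [//|yz] xy] := pselect (D y).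
    by rewrite !g'D ?gM//; exact: Ddown (ltW xy) Dy.
  have py := above y yz nDy; have xz := ltW (lt_le_trans xy yz).
  have [Dx|nDx] := pselect (D x).
    rewrite g'D// g'N//; apply: (@le_lt_trans _ _ (g p)).
      have := Dz x xz Dx; rewrite le_eqVlt => /predU1P[-> //|xp].
      exact/ltW/gM.
    rewrite -Hp ltrD2l; apply: HM; [exact: inP| |by rewrite fL].
    by apply: inP => //; exact: ltW.
  have px := above x xz nDx.
  rewrite !g'N// ltrD2l; apply: HM; last by rewrite fL.
    by apply: inP => //; exact: ltW.
  by apply: inP => //; exact: ltW.
- move=> x; have [Dx _|nDx [//|xz]] := pselect (D x); first by rewrite g'D ?gl.
  have px := ltW (above x xz nDx).
  rewrite g'N// -[leRHS]add0r lerD//.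
  by apply: le_trans (Hl _ (inP x px xz)) _; rewrite /= fK.
- move=> y v yD; rewrite g'D// => rv.
  have old u : D u -> v <= g u -> exists2 w, w <= u & g' w = v.
    move=> Du vu; have [t tu tv] := gS u v Du rv vu.
    by exists t => //; rewrite g'D//; exact: Ddown Du.
  have [Dy|nDy] := pselect (D y); first by rewrite g'D//; exact: old.
  case: yD => // yz vy; have py := above y yz nDy.
  (* Values up to [g p] are already taken inside [D], below [p]; larger ones come from the
     intermediate value theorem for [H] on the segment from [f p] to [f y]. *)
  have [vp|pv] := leP v (g p).
    have [t tp tv] := old p Dp vp.
    by exists t => //; exact: le_trans (ltW py).
  have [|||s] := @IVT R H (f p) (f y) (v - c).
  - by rewrite fE// ltW.
  - exact: continuous_subspaceT.
  - rewrite ge_min le_max; rewrite -Hp in pv; rewrite g'N// in vy.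
    by apply/andP; split; apply/orP; [left|right]; lra.
  rewrite in_itv /= => /andP[ps sy] Hs.
  have [|wz fw] := wE s.
    by rewrite in_itv /= ps (le_trans sy)// fE.
  exists (w s); first by rewrite -fE// fw.
  rewrite g'pz//; last by rewrite -fE ?fw// ltW.
  by rewrite fw Hs addrC subrK.
Qed.

(** If the cut point [p] is missing from [D], only [p] is added, and it need not be [z]: strict
    growth suffices to contradict maximality. Otherwise [p] differs from [z], and the whole segment
    up to [z] is added. *)
Lemma extend_partial_grading (D : set X) (g : X -> R) (z : X) :
  partial_grading D g -> ~ D z ->
  exists D' g', [/\ partial_grading D' g', extends D D' g g' & ~ D' `<=` D].
Proof.
move=> PG nDz; have [Dr Ddown _ _ _] := PG.
have [p [pz Dp Dlt]] := cut_point z Dr Ddown.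
have [inD|nDp] := pselect (D p); last first.
  have [g' [PG' ext]] := extend_at_limit PG nDp Dlt.
  by exists (p |` D), g'; split=> // sub; apply/nDp/sub; left.
have [|g' [PG' ext]] := extend_along_segment (z := z) PG inD _ Dp.
  by rewrite lt_neqAle pz andbT; apply/eqP => pE; rewrite pE in inD.
exists (D `|` [set x | x <= z]), g'; split=> // sub.
by apply/nDz/sub; right => /=.
Qed.

(** * Existence of a total partial grading by Zorn's lemma *)

Lemma root_partial_grading : partial_grading [set r] l.
Proof.
have root x : x <= r -> x = r by move=> xr; apply/le_anti; rewrite xr r_le.
split=> // [x y xy yr|x y -> /[dup] /ltW/root ->|y v -> rv vr].
- by apply: root; rewrite -yr.
- by rewrite ltxx.
- by exists r => //; apply/le_anti; rewrite rv vr.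
Qed.

(** Each condition concerns a point of the union and points below it, all of which lie in one
    downward closed member of the chain; the value at [r] is common to all members. *)
Lemma chain_partial_grading (A : set (set X * (X -> R))) : A !=set0 ->
  (forall t, A t -> partial_grading t.1 t.2) ->
  total_on A (fun t s => extends t.1 s.1 t.2 s.2) ->
  exists D g, partial_grading D g /\
    forall t, A t -> extends t.1 D t.2 g.
Proof.
move=> [t0 At0] PG Atot.
have agree t s x : A t -> A s -> t.1 x -> s.1 x -> t.2 x = s.2 x.
  by move=> At As tx sx; have [[_ ->]|[_ ->]] := Atot t s At As.
(* Outside the union the condition is vacuous, and [l x] is an arbitrary value. *)
have /choice[g gE] x : exists y, forall t, A t -> t.1 x -> y = t.2 x.
  have [[t At tx]|no] := pselect (exists2 t, A t & t.1 x).
    by exists (t.2 x) => s As sx; exact: agree.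
  by exists (l x) => t At tx; case: no; exists t.
have gr t : A t -> g r = t.2 r by move=> At; apply: gE => //; case: (PG t At).
exists (\bigcup_(t in A) t.1), g; split; last first.
  by move=> t At; split=> [x tx|x tx]; [exists t|exact: gE].
split.
- by exists t0 => //; case: (PG t0 At0).
- move=> x y xy [t At ty]; exists t => //.
  by have [_ down _ _ _] := PG t At; exact: down ty.
- move=> x y [t At ty] xy; have [_ down tM _ _] := PG t At.
  by rewrite !(gE _ t)// ?tM//; exact: down (ltW xy) ty.
- move=> x [t At tx]; have [_ _ _ tl _] := PG t At.
  by rewrite (gE _ t)//; exact: tl.
- move=> y v [t At ty]; rewrite (gr t)// (gE _ t)// => rv vy.
  have [_ down _ _ tS] := PG t At; have [w wy wv] := tS y v ty rv vy.
  by exists w => //; rewrite (gE _ t)//; exact: down ty.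
Qed.

Lemma total_partial_grading : exists g, partial_grading setT g.
Proof.
pose T := {t : set X * (X -> R) | partial_grading t.1 t.2}.
pose le_ext (t s : T) :=
  `[< extends (sval t).1 (sval s).1 (sval t).2 (sval s).2 >].
pose t0 : T := exist _ ([set r], l) root_partial_grading.
(* Extension is only a preorder, since functions that agree on [D] may differ elsewhere. Maximality
   thus says that every extension is extended back, which forces [D'] into [D] at the end. *)
have [||A Atot|[[D g] PG] tmax] := @ZL_preorder T t0 le_ext.
- by move=> t; apply/asboolP; split.
- move=> s t u /asboolP[st est] /asboolP[tu etu]; apply/asboolP; split=> x sx.
    exact/tu/st.
  by rewrite etu ?est//; exact: st.
- have [->|A0] := eqVneq A set0; first by exists t0.
  have [|||D [g [PG ub]]] := @chain_partial_grading (sval @` A).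
  + by have /set0P[t At] := A0; exists (sval t), t.
  + by move=> _ [t _ <-]; exact: (svalP t).
  + move=> _ _ [t At <-] [s As <-].
    by have [/asboolP ?|/asboolP ?] := Atot t s At As; [left|right].
  by exists (exist _ (D, g) PG) => s As; apply/asboolP/ub; exists s.
- suff -> : setT = D by exists g.
  apply/seteqP; split=> // z _; apply: contrapT => nDz.
  have [D' [g' [PG' ext nsub]]] := extend_partial_grading PG nDz.
  pose s : T := exist _ (D', g') PG'.
  by have /asboolP[] := tmax s (asboolT ext : le_ext (exist _ (D, g) PG) s).
Qed.

(** Below [y] the order is linear, so the strictly monotonic [g] also reflects it. A point below [y]
    with value at least [g x] therefore lies above [x], so the values in the segment from [g x] to
    [g y] are taken between [x] and [y]. *)
Lemma continuous_grading_of_partial (g : X -> R) :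
  partial_grading setT g -> continuous_grading g.
Proof.
case: hX => -[_ L] _ _ [_ _ gM _ gS].
have gmono : {homo g : x y / x < y} by move=> x y; exact: gM.
have gle x y : x <= y -> (g x <= g y)%R.
  by rewrite le_eqVlt => /predU1P[->//|/gmono/ltW].
split=> // x y xy.
have gE s t : s <= y -> t <= y -> (g s <= g t)%R -> s <= t.
  move=> sy ty st; have [//|] := L y s t sy ty.
  by rewrite le_eqVlt => /predU1P[-> //|/gmono]; rewrite ltNge st.
split; last first.
  move=> s t /=; rewrite !in_itv /= => /andP[_ sy] /andP[_ ty].
  by split; [exact: gle|exact: gE].
split.
- by move=> s /=; rewrite !in_itv /= => /andP[xs sy]; rewrite !gle.
- move=> s t; rewrite !inE /= !in_itv /= => /andP[_ sy] /andP[_ ty] st.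
  by apply/le_anti/andP; split; apply: gE; rewrite ?st.
- move=> v /=; rewrite in_itv /= => /andP[xv vy].
  have [|w wy wv] := gS y v I _ vy; first exact: le_trans (gle _ _ (r_le x)) xv.
  exists w => //=; rewrite in_itv /= wy andbT.
  by apply: gE => //; [exact: ltW|rewrite wv].
Qed.

End Tree.

Theorem theorem4p6 (R : realType) (d : Order.disp_t) (X : porderType d)
    (hX : branchwise_real R X) :
  (exists l : X -> R, continuous_grading l) <-> (exists l : X -> R, grading l).
Proof.
split=> [[l [lM _]]|[l lM]]; first by exists l.
have [[[r r_le] _] _ _] := hX.
have [g PG] := total_partial_grading hX r_le lM.
by exists g; exact: continuous_grading_of_partial PG.
Qed.
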